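(* Let $\Lambda\subset\mathbb{R}^d$ be a lattice or a finite-dimensional vector subspace over a subfield of $\mathbb{R}$, let $(G,\preceq)$ be a partially ordered abelian group, and let $\varphi:\mathcal{P}(\Lambda)\to G$ be a $\Lambda$-valuation. The following are equivalent: (i) $\varphi$ is combinatorially positive; (ii) $f^\varphi_i$ is combinatorially positive for all $i=0,\dots,d$.
   Context: A $\Lambda$-polytope is a convex polytope with vertices in $\Lambda$; $\mathcal{P}(\Lambda)$ is the set of them (including $\emptyset$). A $\Lambda$-valuation is a map $\psi:\mathcal{P}(\Lambda)\to G$ with $\psi(\emptyset)=0$, $\psi(P\cup Q)+\psi(P\cap Q)=\psi(P)+\psi(Q)$ whenever $P,Q,P\cup Q,P\cap Q\in\mathcal{P}(\Lambda)$, and $\psi(t+P)=\psi(P)$ for $t\in\Lambda$. Partially ordered abelian group: $a\preceq b\Rightarrow a+c\preceq b+c$. For an $r$-dimensional $\Lambda$-polytope $P$ there are unique $h_0,\dots,h_r\in G$ with $\psi(nP)=\sum_{i=0}^rh_i\binom{n+r-i}{r}$ for all $n\in\mathbb{Z}_{\ge0}$; $h^\psi_i(P)=h_i$ for $i\le r$, $0$ for $r<i\le d$, $h^\psi(\emptyset)=0$. $\psi$ is combinatorially positive if $h^\psi_i(P)\succeq0$ for all $P\in\mathcal{P}(\Lambda)$ and $0\le i\le d$. The $f^*$-vector of $\varphi$ consists of the $\Lambda$-valuations $f^\varphi_i(P):=\sum_{k=0}^i\binom{i}{k}(-1)^{i-k}\varphi((k+1)P)$, $i=0,\dots,d$; equivalently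 $\varphi(nP)=\sum_{i=0}^df^\varphi_i(P)\binom{n-1}{i}$ for all $n\ge0$. *)

(* Defs.v *)
From HB Require Import structures.
From mathcomp Require Import all_boot all_order all_algebra.
From mathcomp Require Import all_classical all_reals.

Set Implicit Arguments.
Unset Strict Implicit.
Unset Printing Implicit Defensive.
Import Order.TTheory GRing.Theory Num.Theory.

Local Open Scope classical_set_scope.
Local Open Scope ring_scope.

(* Points of R^d are row vectors; a family of m points is an m x d matrix. *)

(* A lattice need not have full rank: m <= d is the rank. *)
Definition is_lattice (R : realType) (d : nat) (L : set 'rV[R]_d) : Prop :=
  exists (m : nat) (B : 'M[R]_(m, d)),
    row_free B /\ L = [set map_mx intr z *m B | z in [set: 'rV[int]_m]].

(* The span over a subfield K of R of finitely many vectors of R^d; these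
   need not be independent over R, so the K-dimension may exceed d. *)
Definition is_subfield_subspace (R : realType) (d : nat)
    (L : set 'rV[R]_d) : Prop :=
  exists (K : {pred R}) (m : nat) (B : 'M[R]_(m, d)),
    GRing.divring_closed K /\
    L = [set c *m B | c in [set c : 'rV[R]_m | forall j, c 0 j \in K]].

Definition conv_hull (R : realType) (d m : nat)
    (X : 'M[R]_(m, d)) : set 'rV[R]_d :=
  [set a *m X | a in
    [set a : 'rV[R]_m | (forall j, 0 <= a 0 j) /\ \sum_j a 0 j = 1]].

(* m = 0 gives the empty polytope. *)
Definition is_polytope (R : realType) (d : nat) (P : set 'rV[R]_d) : Prop :=
  exists (m : nat) (X : 'M[R]_(m, d)), P = conv_hull X.

Definition is_vertex (R : realType) (d : nat) (P : set 'rV[R]_d)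
    (v : 'rV[R]_d) : Prop :=
  P v /\ forall (x y : 'rV[R]_d) (t : R), P x -> P y -> 0 < t < 1 ->
    v = t *: x + (1 - t) *: y -> x = v /\ y = v.

Definition is_Lpolytope (R : realType) (d : nat) (L P : set 'rV[R]_d) : Prop :=
  is_polytope P /\ is_vertex P `<=` L.

Definition dilate (R : realType) (d : nat) (n : nat)
    (P : set 'rV[R]_d) : set 'rV[R]_d :=
  [set n%:R *: x | x in P].

Definition translate (R : realType) (d : nat) (t : 'rV[R]_d)
    (P : set 'rV[R]_d) : set 'rV[R]_d :=
  [set t + x | x in P].

(* A map defined on L-polytopes is represented by a map on all subsets of R^d;
   only its values on L-polytopes are ever constrained or used. *)
Definition is_valuation (R : realType) (d : nat) (G : zmodType)
    (L : set 'rV[R]_d) (psi : set 'rV[R]_d -> G) : Prop :=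
  [/\ psi set0 = 0,
      forall P Q : set 'rV[R]_d,
        is_Lpolytope L P -> is_Lpolytope L Q ->
        is_Lpolytope L (P `|` Q) -> is_Lpolytope L (P `&` Q) ->
        psi (P `|` Q) + psi (P `&` Q) = psi P + psi Q
    & forall (t : 'rV[R]_d) (P : set 'rV[R]_d),
        L t -> is_Lpolytope L P -> psi (translate t P) = psi P].

Definition affine_hull (R : realType) (d : nat)
    (P : set 'rV[R]_d) : set 'rV[R]_d :=
  [set x | exists (m : nat) (X : 'M[R]_(m, d)) (a : 'rV[R]_m),
    [/\ forall j, P (row j X), \sum_j a 0 j = 1 & x = a *m X]].

(* P is nonempty and r-dimensional. *)
Definition has_dim (R : realType) (d : nat) (P : set 'rV[R]_d)
    (r : nat) : Prop :=
  exists (p : 'rV[R]_d) (U : {vspace 'rV[R]_d}),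
    affine_hull P = translate p [set u | u \in U] /\ (\dim U)%VS = r.

(* h is the h^psi-vector of P, extended by 0 to all indices beyond dim P.
   There is at most one such h, by is_h_vector_uniq below; that there is one
   for every valuation and every L-polytope is a theorem of McMullen. *)
Definition is_h_vector (R : realType) (d : nat) (G : zmodType)
    (psi : set 'rV[R]_d -> G) (P : set 'rV[R]_d) (h : nat -> G) : Prop :=
  (P = set0 /\ forall i, h i = 0) \/
  exists r : nat,
    [/\ has_dim P r,
        forall n : nat,
          psi (dilate n P) = \sum_(i < r.+1) h i *+ 'C(n + r - i, r)
      & forall i : nat, (r < i)%N -> h i = 0].

Definition comb_positive (R : realType) (d : nat) (G : porderZmodType)
    (L : set 'rV[R]_d) (psi : set 'rV[R]_d -> G) : Prop :=
  forall P : set 'rV[R]_d, is_Lpolytope L P ->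
    exists h : nat -> G,
      is_h_vector psi P h /\ forall i : nat, (i <= d)%N -> 0 <= h i.

Definition fstar (R : realType) (d : nat) (G : zmodType)
    (phi : set 'rV[R]_d -> G) (i : nat) (P : set 'rV[R]_d) : G :=
  \sum_(k < i.+1) phi (dilate k.+1 P) *~ ((-1) ^+ (i - k) * ('C(i, k))%:Z).

Lemma has_dim_uniq (R : realType) (d : nat) (P : set 'rV[R]_d) (r s : nat) :
  has_dim P r -> has_dim P s -> r = s.
Proof.
have sub (p q : 'rV[R]_d) (U V : {vspace 'rV[R]_d}) :
    translate p [set u | u \in U] = translate q [set u | u \in V] ->
    (U <= V)%VS.
  move=> E; apply/subvP => u uU.
  have : translate p [set u | u \in U] p by exists 0; rewrite /= ?mem0v ?addr0.
  have : translate p [set u | u \in U] (p + u) by exists u.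
  rewrite E => -[v /= vV Ev] [w /= wV Ew].
  suff -> : u = v - w by rewrite rpredB.
  have -> : u = (p + u) - p by rewrite addrC addKr.
  by rewrite -Ev -{1}Ew opprD addrACA subrr add0r.
move=> [p [U [EU <-]]] [q [V [EV <-]]]; congr (\dim _)%VS.
by apply/eqP; rewrite eqEsubv; apply/andP; split; [apply: (sub p q)|apply: (sub q p)];
   rewrite -?EU -EV.
Qed.

Lemma has_dim_neq0 (R : realType) (d : nat) (P : set 'rV[R]_d) (r : nat) :
  has_dim P r -> P <> set0.
Proof.
move=> [p [U [EU _]]] P0.
have : translate p [set u | u \in U] p by exists 0; rewrite /= ?mem0v ?addr0.
rewrite -EU P0 => -[[|m] [X [a [PX /eqP + _]]]]; last by case: (PX ord0).
by rewrite big_ord0 eq_sym oner_eq0.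
Qed.

Lemma is_h_vector_uniq (R : realType) (d : nat) (G : zmodType)
    (psi : set 'rV[R]_d -> G) (P : set 'rV[R]_d) (h h' : nat -> G) :
  is_h_vector psi P h -> is_h_vector psi P h' -> h =1 h'.
Proof.
move=> [[P0 h0]|[r [dP hE h0]]] [[P0' h0']|[r' [dP' hE' h0']]] i.
- by rewrite h0 h0'.
- by case: (has_dim_neq0 dP').
- by case: (has_dim_neq0 dP).
have Err := has_dim_uniq dP dP'; subst r'.
have [ri|] := ltnP r i; first by rewrite h0 ?h0'.
elim/ltn_ind: i => i IH ir.
have := hE i; rewrite hE'.
have ir1 : (i < r.+1)%N by [].
rewrite (bigD1 (Ordinal ir1)) //= [X in _ = X](bigD1 (Ordinal ir1)) //=.
rewrite !addKn binn !mulr1n.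
set S' := \sum_(j < _ | _) _; set S := \sum_(j < _ | _) _.
suff -> : S' = S by move/addIr.
apply: eq_bigr => j /eqP ji.
have [jlt|ilt|Eij] := ltngtP j i; last by case: ji; apply: val_inj.
  by rewrite IH // -ltnS.
have lt_r : (i + r - j < r)%N.
  have jr : (j <= r)%N by rewrite -ltnS.
  by rewrite ltn_subLR ?ltn_add2r // (leq_trans jr) // leq_addl.
by rewrite bin_small // !mulr0n.
Qed.

(* Main.v *)
(** Since [f_0 = phi], only one direction needs an argument.  The number
    ['C(m q + x + r - j, r)] counts chains [z_1, ..., z_r, m q + x] in which [j]
    prescribed steps are strict and the others weak.  Write [z = m p + s] with
    [0 <= s < m], compare the pairs [(p, s)] lexicographically and sum over the
    quotients [p] first: the count becomes
    [\sum_l A_l(x, y) 'C(q + r - l, r)], where [m = x + y + 1] and [A_l(x, y)]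
    counts the residue words with [l] descents.  Such words only matter up to
    relative order, so [A_l] is a nonnegative combination of the products
    ['C(x, a) * 'C(y, b)], [a] and [b] being the numbers of distinct residues
    below and above [x].  For [x = 0] this says that all finite differences of
    [A_l] in [m], taken at [m = 1], are nonnegative; hence the h-vector of [f_i]
    at [P] is a nonnegative combination of that of [phi] at the same [P]. *)
Require Import Defs.
From mathcomp Require Import all_boot all_order all_algebra.
From mathcomp Require Import all_classical all_reals.
From mathcomp Require Import zify.
Set Implicit Arguments.
Unset Strict Implicit.
Import Order.TTheory GRing.Theory Num.Theory.
Local Open Scope classical_set_scope.
Local Open Scope ring_scope.

(** * Summation identities for binomials *)

Lemma sum_bin (N r j : nat) : (j <= r)%N ->
  (\sum_(0 <= z < N) 'C(z + r - j, r) = 'C(N + r - j, r.+1))%N.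
Proof.
move=> jr; elim: N => [|N IH]; first by rewrite big_nil bin_small //; lia.
rewrite big_nat_recr //= IH.
have -> : (N.+1 + r - j = (N + r - j).+1)%N by lia.
by rewrite binS.
Qed.

(** Both sides count subsets of size [a + b + 1] of [n] points, the left one by the element [s] with
    [a] chosen points below it and [b] above. *)
Lemma sum_bin_mul (n a b : nat) :
  (\sum_(0 <= s < n) 'C(s, a) * 'C(n.-1 - s, b) = 'C(n, (a + b).+1))%N.
Proof.
elim: n b => [|n IH] b; first by rewrite big_nil.
case: b => [|b].
  under eq_bigr => s _ do rewrite bin0 muln1.
  have := @sum_bin n.+1 a a (leqnn a); rewrite addnK addn0 => <-.
  by apply: eq_bigr => s _; rewrite addnK.
rewrite big_nat_recr //= subnn bin0n muln0 addn0 addnS binS -IH.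
have := IH b.+1; rewrite addnS => <-.
rewrite -big_split /=; apply: eq_big_nat => s /andP[_ sn].
have -> : (n - s = (n.-1 - s).+1)%N by lia.
by rewrite binS mulnDr.
Qed.

(** * The cone spanned by products of two binomials *)

Inductive bin_cone : (nat -> nat -> nat) -> Prop :=
| bin_cone_basis a b : bin_cone (fun x y => 'C(x, a) * 'C(y, b))%N
| bin_cone0 : bin_cone (fun _ _ => 0%N)
| bin_coneD f g : bin_cone f -> bin_cone g ->
    bin_cone (fun x y => f x y + g x y)%N.

Lemma bin_cone_ext (f g : nat -> nat -> nat) :
  bin_cone f -> f =2 g -> bin_cone g.
Proof.
by move=> + fg; suff -> : f = g by []; apply/funext => x; apply/funext => y.
Qed.

Lemma bin_cone_sum (I : Type) (s : seq I) (f : I -> nat -> nat -> nat) :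
  (forall i, bin_cone (f i)) -> bin_cone (fun x y => \sum_(i <- s) f i x y)%N.
Proof.
move=> hf; elim: s => [|i s IH].
  by apply: (bin_cone_ext bin_cone0) => x y; rewrite big_nil.
by apply: (bin_cone_ext (bin_coneD (hf i) IH)) => x y; rewrite big_cons.
Qed.

Lemma bin_coneMl (f : nat -> nat -> nat) (k : nat) :
  bin_cone f -> bin_cone (fun x y => k * f x y)%N.
Proof.
move=> hf; elim: k => [|k IH]; first exact: bin_cone0.
by apply: (bin_cone_ext (bin_coneD hf IH)) => x y; rewrite mulSn.
Qed.

Lemma bin_cone_swap (f : nat -> nat -> nat) :
  bin_cone f -> bin_cone (fun x y => f y x).
Proof.
elim=> [a b||g h _ hg _ hh]; last exact: bin_coneD.
  by apply: (bin_cone_ext (bin_cone_basis b a)) => x y; rewrite mulnC.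
exact: bin_cone0.
Qed.

(** Here [s] is the residue preceding a last residue [x]; among the same [x + y + 1] residues it has
    [s] below it and [x + y - s] above. *)
Lemma bin_cone_sum_below (f : nat -> nat -> nat) : bin_cone f ->
  bin_cone (fun x y => \sum_(0 <= s < x) f s (x + y - s))%N.
Proof.
elim=> [a b||g h _ hg _ hh]; first last.
- by apply: (bin_cone_ext (bin_coneD hg hh)) => x y; rewrite big_split.
- by apply: (bin_cone_ext bin_cone0) => x y; rewrite big1.
(* Vandermonde on [x + y - s = y.+1 + (x.-1 - s)]. *)
have hS c : bin_cone (fun x y => 'C(x, (a + (b - c)).+1) * 'C(y.+1, c))%N.
  case: c => [|c].
    by apply: (bin_cone_ext (bin_cone_basis (a + b).+1 0)) => x y; rewrite subn0 !bin0.
  apply: (bin_cone_ext (bin_coneD (bin_cone_basis (a + (b - c.+1)).+1 c.+1)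
                                  (bin_cone_basis (a + (b - c.+1)).+1 c))).
  by move=> x y; rewrite binS mulnDr.
apply: (bin_cone_ext (bin_cone_sum (index_iota 0 b.+1) hS)) => x y /=.
under eq_bigr => c _ do rewrite -sum_bin_mul big_distrl /=.
rewrite exchange_big /=; apply: eq_big_nat => s /andP[_ sx].
have -> : (x + y - s = y.+1 + (x.-1 - s))%N by lia.
rewrite -binomial.Vandermonde big_mkord big_distrr /=; apply: eq_bigr => c _.
by rewrite mulnAC mulnA.
Qed.

(** Reversing the order of the residues swaps the two arguments and turns this sum into the one
    below [x]. *)
Lemma bin_cone_sum_above (f : nat -> nat -> nat) : bin_cone f ->
  bin_cone (fun x y => \sum_(x.+1 <= s < (x + y).+1) f s (x + y - s))%N.
Proof.
move/bin_cone_swap/bin_cone_sum_below/bin_cone_swap => hf.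
apply: (bin_cone_ext hf) => x y.
rewrite [RHS]big_nat_rev -{1}[x.+1]add0n big_addn /=.
have -> : ((x + y).+1 - x.+1 = y)%N by lia.
apply: eq_big_nat => s /andP[_ sy]; congr (f _ _); lia.
Qed.

(** * Descents of residue words *)

(** The order on pairs (quotient, remainder) is lexicographic, so a remainder below [t] admits the
    extra quotient [q]. *)
Lemma sum_quotient_remainder (m q t : nat) (F : nat -> nat) : (t <= m)%N ->
  (\sum_(0 <= z < m * q + t) F z =
   \sum_(0 <= s < t) \sum_(0 <= p < q.+1) F (m * p + s) +
   \sum_(t <= s < m) \sum_(0 <= p < q) F (m * p + s))%N.
Proof.
move=> tm.
have hb n k : (\sum_(0 <= z < m * n + k) F z =
    \sum_(0 <= z < m * n) F z + \sum_(0 <= s < k) F (m * n + s))%N.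
  rewrite (big_cat_nat (n := m * n)) ?leq_addr //=; congr addn.
  rewrite -{1}[(m * n)%N]add0n big_addn addKn.
  by apply: eq_bigr => s _; rewrite addnC.
have hq n : (\sum_(0 <= z < m * n) F z =
    \sum_(0 <= s < m) \sum_(0 <= p < n) F (m * p + s))%N.
  elim: n => [|n IH]; first by rewrite muln0 big_nil big1 // => s _; rewrite big_nil.
  rewrite mulnS addnC hb IH -big_split /=.
  by apply: eq_bigr => s _; rewrite big_nat_recr.
rewrite hb hq (big_cat_nat (n := t)) //= addnAC; congr addn.
by rewrite -big_split /=; apply: eq_bigr => s _; rewrite big_nat_recr.
Qed.

(* [e] is [1] for a weak last step of the chain and [0] for a strict one. *)
Lemma bin_descent_step (e : bool) (r j : nat) (A : nat -> nat -> nat -> nat) :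
  (j <= r)%N -> (forall l, bin_cone (A l)) ->
  (forall x y q, 'C((x + y).+1 * q + x + r - j, r) =
     \sum_(l < r.+1) A l x y * 'C(q + r - l, r))%N ->
  exists B : nat -> nat -> nat -> nat, (forall l, bin_cone (B l)) /\
    (forall x y q, 'C((x + y).+1 * q + (x + e) + r - j, r.+1) =
       \sum_(l < r.+2) B l x y * 'C(q + r.+1 - l, r.+1))%N.
Proof.
move=> jr hA hC.
(* The previous chain entry may share the last quotient [q] if its residue is below [x + e];
   otherwise its quotient is smaller, which costs a descent. *)
pose lo l x y := (\sum_(0 <= s < x + e) A l s (x + y - s))%N.
pose up l x y := (\sum_(x + e <= s < (x + y).+1) A l s (x + y - s))%N.
have hlo l : bin_cone (lo l).
  rewrite /lo; case: (e) => /=; last first.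
    by apply: (bin_cone_ext (bin_cone_sum_below (hA l))) => x y; rewrite addn0.
  apply: (bin_cone_ext (bin_coneD (bin_cone_sum_below (hA l)) (hA l))) => x y.
  by rewrite addn1 big_nat_recr //= addKn.
have hup l : bin_cone (up l).
  rewrite /up; case: (e) => /=.
    by apply: (bin_cone_ext (bin_cone_sum_above (hA l))) => x y; rewrite addn1.
  apply: (bin_cone_ext (bin_coneD (hA l) (bin_cone_sum_above (hA l)))) => x y.
  by rewrite addn0 [RHS]big_ltn ?ltnS ?leq_addr //= addKn.
(* The shift of [up] records the new descent; the guards drop [l = r + 1] from [lo] and [l = 0] from
   [up]. *)
exists (fun l x y => (l <= r) * lo l x y + (0 < l) * up l.-1 x y)%N; split.
  by move=> l; apply: bin_coneD; apply: bin_coneMl.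
move=> x y q.
have hs : (x + e <= (x + y).+1)%N by have := leq_b1 e; lia.
have hsum s Q : (s < (x + y).+1)%N ->
    (\sum_(0 <= p < Q) 'C((x + y).+1 * p + s + r - j, r) =
     \sum_(l < r.+1) A l s (x + y - s) * 'C(Q + r - l, r.+1))%N.
  move=> sm.
  under eq_bigr => p _.
    rewrite -{1}[(x + y)%N](@subnKC s) // hC; over.
  rewrite exchange_big /=; apply: eq_bigr => l _.
  by rewrite -big_distrr /= sum_bin // -ltnS.
rewrite addnA -sum_bin // -addnA sum_quotient_remainder //.
under [in RHS]eq_bigr => l _ do rewrite mulnDl.
rewrite [RHS]big_split /=; congr addn.
- rewrite big_ord_recr /= ltnn mul0n addn0.
  under [RHS]eq_bigr => l _.
    rewrite -ltnS ltn_ord mul1n big_distrl /=; over.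
  rewrite [RHS]exchange_big /=; apply: eq_big_nat => s /andP[_ sx].
  rewrite hsum; last exact: leq_trans hs.
  by apply: eq_bigr => l _; rewrite addSnnS.
- rewrite big_ord_recl /= add0n.
  under [RHS]eq_bigr => l _.
    rewrite /bump /= add1n /= mul1n big_distrl /= addnS subSS; over.
  rewrite [RHS]exchange_big /=; apply: eq_big_nat => s /andP[_ sx].
  by rewrite hsum.
Qed.

Lemma bin_descent_expansion (r j : nat) : (j <= r)%N ->
  exists A : nat -> nat -> nat -> nat, (forall l, bin_cone (A l)) /\
    (forall x y q, 'C((x + y).+1 * q + x + r - j, r) =
       \sum_(l < r.+1) A l x y * 'C(q + r - l, r))%N.
Proof.
elim: r j => [|r IH] j jr.
  exists (fun _ x y => 'C(x, 0) * 'C(y, 0))%N; split=> [l|x y q].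
    exact: bin_cone_basis.
  by rewrite big_ord1 !bin0.
(* For [j <= r] a weak step is appended; for [j = r + 1] all steps are strict, so a strict one
   is. *)
have [j_le|j_gt] := leqP j r.
  have [A [hA hC]] := IH _ j_le.
  have [B [hB hE]] := bin_descent_step true j_le hA hC.
  exists B; split=> // x y q; rewrite -hE /=; congr 'C(_, _); lia.
have -> : j = r.+1 by lia.
have [A [hA hC]] := IH r (leqnn r).
have [B [hB hE]] := bin_descent_step false (leqnn r) hA hC.
exists B; split=> // x y q; rewrite -hE /=; congr 'C(_, _); lia.
Qed.

(** * Finite differences at zero *)

Lemma finite_differenceS (i : nat) (f : nat -> int) :
  \sum_(k < i.+2) f k * ((-1) ^+ (i.+1 - k) * ('C(i.+1, k))%:Z) =
  \sum_(k < i.+1) (f k.+1 - f k) * ((-1) ^+ (i - k) * ('C(i, k))%:Z).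
Proof.
under [RHS]eq_bigr => k _ do rewrite mulrBl.
rewrite sumrB big_ord_recl [X in _ = _ - X]big_ord_recl /=.
rewrite !bin0 !subn0 exprS !mulN1r.
under eq_bigr => k _ do rewrite /bump /= add1n subSS binS PoszD !mulrDr.
rewrite big_split /= big_ord_recr /= (@bin_small i i.+1) // !mulr0 addr0.
have -> : \sum_(k < i) f k.+1 * ((-1) ^+ (i - k) * ('C(i, k.+1))%:Z) =
    - \sum_(k < i) f (bump 0 k) * ((-1) ^+ (i - bump 0 k) * ('C(i, bump 0 k))%:Z).
  rewrite -sumrN; apply: eq_bigr => k _; rewrite /bump /= add1n.
  have -> : (i - k = (i - k.+1).+1)%N by have := ltn_ord k; lia.
  by rewrite exprS mulN1r mulNr mulrN.
by rewrite mulNr mulrN addrA -opprD addrC.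
Qed.

(** By Pascal's rule the forward difference of ['C(k, b.+1)] is ['C(k, b)], so [i] and [b] drop
    together. *)
Lemma finite_difference_bin (i b : nat) :
  \sum_(k < i.+1) ('C(k, b))%:Z * ((-1) ^+ (i - k) * ('C(i, k))%:Z) =
  (i == b)%:Z.
Proof.
elim: i b => [|i IH] b.
  by rewrite big_ord1 /= !bin0n /= !mulr1 eq_sym.
rewrite (finite_differenceS i (fun k => ('C(k, b))%:Z)).
case: b => [|b]; first by rewrite big1 // => k _; rewrite !bin0 subrr mul0r.
rewrite eqSS -IH; apply: eq_bigr => k _.
by rewrite binS PoszD addrAC subrr add0r.
Qed.

Lemma bin_cone_finite_difference (i : nat) (g : nat -> nat -> nat) :
  bin_cone g -> exists c : nat,
  \sum_(k < i.+1) (g 0%N k)%:Z * ((-1) ^+ (i - k) * ('C(i, k))%:Z) = c%:Z.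
Proof.
elim=> [a b||f h _ [cf Ef] _ [ch Eh]].
- exists ('C(0, a) * (i == b))%N.
  rewrite PoszM -finite_difference_bin mulr_sumr.
  by apply: eq_bigr => k _; rewrite PoszM mulrA.
- by exists 0%N; rewrite big1 // => k _; rewrite mul0r.
- exists (cf + ch)%N; rewrite PoszD -Ef -Eh -big_split /=.
  by apply: eq_bigr => k _; rewrite PoszD mulrDl.
Qed.

Lemma bin_dilate_finite_difference (r j i : nat) : (j <= r)%N ->
  exists c : nat -> nat, forall n : nat,
  \sum_(k < i.+1) ('C(k.+1 * n + r - j, r))%:Z *
    ((-1) ^+ (i - k) * ('C(i, k))%:Z) =
  (\sum_(l < r.+1) c l * 'C(n + r - l, r))%N%:Z.
Proof.
move=> /bin_descent_expansion[A [hA hC]].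
have /boolp.choice[c hc] := fun l => bin_cone_finite_difference i (hA l).
exists c => n.
(* Taking [x = 0] and [y = k] makes the modulus [k + 1], the dilation factor. *)
have hk k : 'C(k.+1 * n + r - j, r) =
    (\sum_(l < r.+1) A l 0 k * 'C(n + r - l, r))%N.
  by rewrite -hC add0n addn0.
under eq_bigr => k _ do rewrite hk -natz natr_sum big_distrl /=.
rewrite exchange_big /= -[RHS]natz natr_sum; apply: eq_bigr => l _.
rewrite natz PoszM -hc mulr_suml; apply: eq_bigr => k _.
by rewrite natz PoszM mulrAC.
Qed.

(** * Transfer of h-vectors *)

Lemma dilate_dilate (R : realType) (d m n : nat) (P : set 'rV[R]_d) :
  dilate m (dilate n P) = dilate (m * n) P.
Proof.
by rewrite /dilate image_comp; apply: eq_imagel => x _ /=; rewrite scalerA natrM.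
Qed.

Lemma dilate1 (R : realType) (d : nat) (P : set 'rV[R]_d) : dilate 1 P = P.
Proof.
by apply: eq_image_id => x _; rewrite scale1r.
Qed.

Lemma fstar0 (R : realType) (d : nat) (G : zmodType)
    (phi : set 'rV[R]_d -> G) : fstar phi 0 = phi.
Proof.
by apply/funext => P; rewrite /fstar big_ord1 dilate1 subnn bin0 mulr1.
Qed.

Lemma has_dim_le (R : realType) (d : nat) (P : set 'rV[R]_d) (r : nat) :
  has_dim P r -> (r <= d)%N.
Proof.
move=> [p [U [_ <-]]]; apply: leq_trans (dimvS (subvf U)) _.
by rewrite dimvf /dim /= mul1n.
Qed.

Unset Implicit Arguments.
Set Strict Implicit.

Theorem theorem7p3 (R : realType) (d : nat) (L : set 'rV[R]_d)
    (hL : is_lattice L \/ is_subfield_subspace L)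
    (G : porderZmodType)
    (hG : forall a b c : G, a <= b -> a + c <= b + c)
    (phi : set 'rV[R]_d -> G) (hphi : is_valuation L phi) :
  comb_positive L phi <->
  (forall i : nat, (i <= d)%N -> comb_positive L (fstar phi i)).
Proof.
split=> [pos i _ P LP|/(_ 0%N (leq0n d))]; last by rewrite fstar0.
have [h [[[P0 _]|[r [dP hE _]]] h_ge0]] := pos P LP.
  by exists (fun=> 0); split=> //; left.
have sum_ge0 (I : Type) (s : seq I) (F : I -> G) :
    (forall x, 0 <= F x) -> 0 <= \sum_(x <- s) F x.
  move=> F0; elim: s => [|x s IH]; first by rewrite big_nil.
  rewrite big_cons; apply: le_trans IH _.
  by rewrite -[leLHS]add0r; apply: hG.
have /fin_all_exists[c hc] : forall j : 'I_r.+1, exists c : nat -> nat,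
    forall n : nat, \sum_(k < i.+1) ('C(k.+1 * n + r - j, r))%:Z *
      ((-1) ^+ (i - k) * ('C(i, k))%:Z) =
    (\sum_(l < r.+1) c l * 'C(n + r - l, r))%N%:Z.
  by move=> j; apply: bin_dilate_finite_difference; rewrite -ltnS.
(* Each [h j] is spread over the indices [l] with the natural weights [c j l]; beyond [dim P] the
   vector is zero by convention. *)
exists (fun l => if (l <= r)%N then \sum_(j < r.+1) h j *+ c j l else 0).
split; last first.
  move=> l _; case: ifP => // _; apply: sum_ge0 => j.
  have hj : 0 <= h j.
    (* Positivity of [h j] is known only up to [d], hence the bound [dim P <= d]. *)
    by apply: h_ge0; apply: leq_trans (has_dim_le dP); rewrite -ltnS.
  rewrite -[_ *+ _]addr0 -iter_addr; elim: (c j l) => //= n IH.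
  by apply: le_trans IH _; rewrite -[leLHS]add0r; apply: hG.
right; exists r; split=> // [n|l rl]; last by rewrite leqNgt rl.
rewrite /fstar.
under eq_bigr => k _ do rewrite dilate_dilate hE mulrz_suml.
rewrite exchange_big /=.
transitivity (\sum_(j < r.+1) \sum_(l < r.+1) h j *+ c j l *+ 'C(n + r - l, r)).
  apply: eq_bigr => j _.
  under eq_bigr => k _ do rewrite pmulrn -mulrzA.
  (* The alternating sum over [k] now acts only on the integer coefficient of [h j]. *)
  rewrite -mulrz_sumr hc -pmulrn -sumrMnr.
  by apply: eq_bigr => l _; rewrite mulrnA.
rewrite exchange_big /=; apply: eq_bigr => l _.
by rewrite -ltnS ltn_ord sumrMnl.
Qed.
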